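(* Let $\mathsf{Eq}$ be a set of equations containing the set $\mathsf{DN}$ of equations axiomatizing distributive lattices with negation, and let $\mathbb{V}_{\mathsf{Eq}}$ be the variety axiomatized by $\mathsf{Eq}$. Then $\vdash_{\mathcal{R}^{\mathsf{Eq}}_\omega\cup\mathcal{R}_{\mathsf{F}}}\;=\;\vdash^{\leq}_{\mathbb{V}_{\mathsf{Eq}}}$.
   Context: Language: binary $\land,\lor$, unary $\neg$, constants $\bot,\top$; $Fm$ is the set of formulas over a countably infinite set of variables; an equation is a pair $\varphi\approx\psi$ of formulas. $\mathsf{DN}$ is the set of equations: $x\lor y\approx y\lor x$, $x\land y\approx y\land x$, $x\lor(y\lor z)\approx(x\lor y)\lor z$, $x\land(y\land z)\approx(x\land y)\land z$, $x\lor x\approx x$, $x\land x\approx x$, $x\lor(x\land y)\approx x$, $x\land(x\lor y)\approx x$, $x\land\bot\approx\bot$, $x\lor\top\approx\top$, $x\land(y\lor z)\approx(x\land y)\lor(x\land z)$, $\neg\bot\approx\top$, $\neg(x\lor y)\approx\neg x\land\neg y$. For a class $\mathbb{K}$ of algebras of this type with bounded lattice reducts, $\Gamma\vdash^{\leq}_{\mathbb{K}}\varphi$ iff for every $\mathbf{A}\in\mathbb{K}$, every non-empty lattice filter $F$ of $\mathbf{A}$ and every homomorphism $h\colon Fm\to A$, $h[\Gamma]\subseteq F$ implies $h(\varphi)\in F$. A rule is a pair $\frac{\Gamma}{\varphi}$ with $\Gamma$ a finite set of formulas; $\vdash_{\mathcal{R}}$ denotes derivability by Hilbert derivations using substitution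 instances of rules in $\mathcal{R}$. For a set $\mathsf{Eq}$ of equations, $\mathcal{R}^{\mathsf{Eq}}=\{\frac{\varphi}{\psi},\frac{\psi}{\varphi}:\varphi\approx\psi\in\mathsf{Eq}\}$. For a set $\mathcal{R}$ of single-premise rules, fix fresh variables $q_0,q_1,\dots$ not occurring in $\mathcal{R}$ and set $\mathcal{R}_0=\mathcal{R}$, $\mathcal{R}_{n+1}=\{\frac{\varphi\lor q_n}{\psi\lor q_n},\frac{\varphi\land q_n}{\psi\land q_n},\frac{\neg\psi}{\neg\varphi}:\frac{\varphi}{\psi}\in\mathcal{R}_n\}$, $\mathcal{R}_\omega=\bigcup_{n<\omega}\mathcal{R}_n$; $\mathcal{R}^{\mathsf{Eq}}_\omega$ denotes $(\mathcal{R}^{\mathsf{Eq}})_\omega$. Finally $\mathcal{R}_{\mathsf{F}}=\{\frac{}{\top},\frac{p\,,\,q}{p\land q},\frac{p}{p\lor q}\}$. *)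

(* Defs.v *)
From Stdlib Require List.
From mathcomp Require Import all_boot classical_sets.

Set Implicit Arguments.
Unset Strict Implicit.
Unset Printing Implicit Defensive.

Local Open Scope classical_set_scope.

Inductive fm (V : Type) : Type :=
| Var of V
| Bot
| Top
| And of fm V & fm V
| Or of fm V & fm V
| Neg of fm V.

Arguments Bot {V}.
Arguments Top {V}.

Declare Scope fm_scope.
Delimit Scope fm_scope with fm.
Bind Scope fm_scope with fm.
Notation "¬ x" := (Neg x) (at level 35, right associativity) : fm_scope.
Notation "x ∧ y" := (And x y) (at level 40, left associativity) : fm_scope.
Notation "x ∨ y" := (Or x y) (at level 50, left associativity) : fm_scope.
Notation "⊥" := Bot : fm_scope.
Notation "⊤" := Top : fm_scope.

Fixpoint subst (V W : Type) (s : V -> fm W) (phi : fm V) : fm W :=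
  match phi with
  | Var v => s v
  | Bot => Bot
  | Top => Top
  | And a b => And (subst s a) (subst s b)
  | Or a b => Or (subst s a) (subst s b)
  | Neg a => Neg (subst s a)
  end.

Fixpoint occurs (V : Type) (v : V) (phi : fm V) : Prop :=
  match phi with
  | Var w => v = w
  | Bot | Top => False
  | And a b | Or a b => occurs v a \/ occurs v b
  | Neg a => occurs v a
  end.

Definition equation (V : Type) : Type := (fm V * fm V)%type.

Notation "x ≈ y" := (@pair (fm _) (fm _) x%fm y%fm)
  (at level 70, no associativity) : fm_scope.

(* The finite premise set is a list of which only membership is ever used. *)
Record rule (V : Type) : Type := Rule { prems : seq (fm V); concl : fm V }.

Definition occurs_rule (V : Type) (v : V) (r : rule V) : Prop :=
  occurs v (concl r) \/ exists2 p, List.In p (prems r) & occurs v p.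

Definition rename_rule (V W : Type) (e : V -> W) (r : rule V) : rule W :=
  let ren := subst (fun v => Var (e v)) in
  Rule [seq ren p | p <- prems r] (ren (concl r)).

(* Derivations are finite sequences of formulas, listed from the last formula
   to the first.  The variables of the rules may be drawn from a set [W] other
   than the set [V] of variables of the object language: an instance of a rule
   is obtained from a substitution [W -> fm V]. *)
Inductive derivation (W V : Type) (R : set (rule W)) (Gamma : set (fm V)) :
    seq (fm V) -> Prop :=
| derivation_nil : derivation R Gamma [::]
| derivation_hyp phi l :
    derivation R Gamma l -> Gamma phi -> derivation R Gamma (phi :: l)
| derivation_rule r (s : W -> fm V) l :
    derivation R Gamma l -> R r ->
    (forall p, List.In p (prems r) -> List.In (subst s p) l) ->
    derivation R Gamma (subst s (concl r) :: l).

Definition derivable (W V : Type) (R : set (rule W))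
    (Gamma : set (fm V)) (phi : fm V) : Prop :=
  exists l, derivation R Gamma (phi :: l).

Record algebra : Type := Algebra {
  carrier :> Type;
  bot : carrier;
  top : carrier;
  meet : carrier -> carrier -> carrier;
  join : carrier -> carrier -> carrier;
  neg : carrier -> carrier }.

Definition fm_algebra (V : Type) : algebra :=
  @Algebra (fm V) Bot Top (@And V) (@Or V) (@Neg V).

Definition is_hom (A B : algebra) (h : A -> B) : Prop :=
  [/\ h (bot A) = bot B,
      h (top A) = top B,
      forall x y, h (meet x y) = meet (h x) (h y),
      forall x y, h (join x y) = join (h x) (h y)
    & forall x, h (neg x) = neg (h x)].

Definition satisfies (V : Type) (A : algebra) (eqn : equation V) : Prop :=
  forall h : fm_algebra V -> A, is_hom h -> h eqn.1 = h eqn.2.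

Definition variety (V : Type) (Eq : set (equation V)) : set algebra :=
  [set A | forall eqn, Eq eqn -> satisfies A eqn].

Definition le (A : algebra) (x y : A) : Prop := meet x y = x.

Definition nonempty_filter (A : algebra) (F : set A) : Prop :=
  [/\ F !=set0,
      forall x y, F x -> F y -> F (meet x y)
    & forall x y, F x -> le x y -> F y].

Definition order_consequence (V : Type) (K : set algebra)
    (Gamma : set (fm V)) (phi : fm V) : Prop :=
  forall A : algebra, K A ->
  forall F : set A, nonempty_filter F ->
  forall h : fm_algebra V -> A, is_hom h ->
  h @` Gamma `<=` F -> F (h phi).

Definition DN : set (equation nat) :=
  let x := Var 0 in let y := Var 1 in let z := Var 2 in
  [set eqn | List.In eqn [::
    x ∨ y ≈ y ∨ x;
    x ∧ y ≈ y ∧ x;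
    x ∨ (y ∨ z) ≈ (x ∨ y) ∨ z;
    x ∧ (y ∧ z) ≈ (x ∧ y) ∧ z;
    x ∨ x ≈ x;
    x ∧ x ≈ x;
    x ∨ (x ∧ y) ≈ x;
    x ∧ (x ∨ y) ≈ x;
    x ∧ ⊥ ≈ ⊥;
    x ∨ ⊤ ≈ ⊤;
    x ∧ (y ∨ z) ≈ (x ∧ y) ∨ (x ∧ z);
    ¬ ⊥ ≈ ⊤;
    ¬ (x ∨ y) ≈ ¬ x ∧ ¬ y]%fm].

Definition rules_of (V : Type) (Eq : set (equation V)) : set (rule V) :=
  [set r | exists phi psi, Eq (phi, psi) /\
     (r = Rule [:: phi] psi \/ r = Rule [:: psi] phi)].

Fixpoint rules_iter (W : Type) (q : nat -> W) (R : set (rule W)) (n : nat) :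
    set (rule W) :=
  if n is m.+1 then
    [set r | exists phi psi, rules_iter q R m (Rule [:: phi] psi) /\
       [\/ r = Rule [:: Or phi (Var (q m))] (Or psi (Var (q m))),
           r = Rule [:: And phi (Var (q m))] (And psi (Var (q m)))
         | r = Rule [:: Neg psi] (Neg phi)]]
  else R.

Definition rules_omega (W : Type) (q : nat -> W) (R : set (rule W)) :
    set (rule W) :=
  \bigcup_n rules_iter q R n.

Definition fresh (W : Type) (q : nat -> W) (R : set (rule W)) : Prop :=
  injective q /\ forall n r, R r -> ~ occurs_rule (q n) r.

Definition rules_F : set (rule nat) :=
  let p := Var 0 in let q := Var 1 in
  [set r | List.In r [::
    Rule [::] Top;
    Rule [:: p; q] (And p q);
    Rule [:: p] (Or p q)]].

(* Main.v *)
Require Import Defs.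
From mathcomp Require Import all_boot boolp classical_sets.

Set Implicit Arguments.
Unset Strict Implicit.
Unset Printing Implicit Defensive.

Local Open Scope classical_set_scope.

(* Soundness: in an algebra of the variety the two sides of every rule of
   [rules_omega] take the same value, because the iteration only plugs the two
   sides of an equation into a common context.

   Completeness: for a theory T of the calculus, identify two formulas when no
   context built from [_ ∨ chi], [_ ∧ chi] and [¬ _] separates them with respect
   to T.  The iterated rules put every instance of [Eq] into this relation, and
   commutativity makes it a congruence although holes only occur on the left.
   The quotient is thus in the variety, and the rules [rules_F] make the image
   of T a filter whose preimage is T. *)

(** * Closure properties of derivability *)

Section Derivability.

Variables (W V : Type) (R : set (rule W)) (Gamma : set (fm V)).

Lemma derivation_cat l1 l2 :
  derivation R Gamma l1 -> derivation R Gamma l2 ->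
  derivation R Gamma (l1 ++ l2).
Proof.
move=> d1 d2; elim: d1 => [//|phi l _ IH Gphi|r s l _ IH Rr prem_l] /=.
  exact: derivation_hyp.
apply: derivation_rule => // p /prem_l pl.
by apply/List.in_app_iff; left.
Qed.

Lemma derivable_hyp phi : Gamma phi -> derivable R Gamma phi.
Proof.
by move=> Gphi; exists [::]; apply: derivation_hyp => //; exact: derivation_nil.
Qed.

(** Derivations of the finitely many premises can be concatenated into one, to which the rule is
    then applied. *)
Lemma derivable_rule r (s : W -> fm V) :
  R r -> (forall p, List.In p (prems r) -> derivable R Gamma (subst s p)) ->
  derivable R Gamma (subst s (concl r)).
Proof.
move=> Rr dprem.
suff [l dl lP] : exists2 l, derivation R Gamma l &
    forall p, List.In p (prems r) -> List.In (subst s p) l.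
  by exists l; exact: derivation_rule.
elim: (prems r) dprem => [_|p ps IH dps]; first by exists [::] => //; exact: derivation_nil.
have [l1 d1] := dps p (or_introl erefl).
have [l2 d2 l2P] := IH (fun p' p'ps => dps p' (or_intror p'ps)).
exists ((subst s p :: l1) ++ l2); first exact: derivation_cat.
move=> p' /= [<-|/l2P p'l2]; first by left.
by right; apply/List.in_app_iff; right.
Qed.

End Derivability.

(** * Substitutions and homomorphisms *)

Lemma subst_comp (U V W : Type) (s : U -> fm V) (t : V -> fm W) phi :
  subst t (subst s phi) = subst (fun u => subst t (s u)) phi.
Proof.
by elim: phi => //= [a -> b ->|a -> b ->|a ->].
Qed.

Lemma eq_subst_occurs (V W : Type) (s t : V -> fm W) phi :
  (forall v, occurs v phi -> s v = t v) -> subst s phi = subst t phi.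
Proof.
elim: phi => //= [v|a IHa b IHb|a IHa b IHb|a IHa] st; first exact: st.
- by rewrite IHa ?IHb // => v ?; apply: st; [right|left].
- by rewrite IHa ?IHb // => v ?; apply: st; [right|left].
- by rewrite IHa.
Qed.

Lemma occurs_rename (V W : Type) (e : V -> W) v phi :
  occurs v phi -> occurs (e v) (subst (fun u => Var (e u)) phi).
Proof.
elim: phi => //= [u ->//|a IHa b IHb|a IHa b IHb].
- by case=> [/IHa|/IHb]; [left|right].
- by case=> [/IHa|/IHb]; [left|right].
Qed.

Lemma is_hom_subst (U V : Type) (A : algebra) (s : U -> fm V)
    (h : fm_algebra V -> A) :
  is_hom h -> is_hom (A := fm_algebra U) (fun phi => h (subst s phi)).
Proof.
move=> [h0 h1 hM hJ hN]; split=> //= [x y|x y|x].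
- exact: hM.
- exact: hJ.
- exact: hN.
Qed.

Fixpoint eval (V : Type) (A : algebra) (f : V -> A) (phi : fm V) : A :=
  match phi with
  | Var v => f v
  | Bot => bot A
  | Top => top A
  | And a b => meet (eval f a) (eval f b)
  | Or a b => join (eval f a) (eval f b)
  | Neg a => neg (eval f a)
  end.

Lemma is_hom_eval (V : Type) (A : algebra) (f : V -> A) :
  is_hom (A := fm_algebra V) (eval f).
Proof. by split. Qed.

(** Serves to lift a valuation in a quotient to a substitution that picks representatives, so that
    equations in the quotient reduce to substitution instances. *)
Lemma hom_eq_subst (V W : Type) (B : algebra)
    (p : fm_algebra W -> B) (h : fm_algebra V -> B) (s : V -> fm W) :
  is_hom p -> is_hom h -> (forall v, p (s v) = h (Var v)) ->
  forall phi, h phi = p (subst s phi).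
Proof.
move=> [p0 p1 pM pJ pN] [h0 h1 hM hJ hN] ps.
elim=> [v|||a IHa b IHb|a IHa b IHb|a IHa] /=.
- by rewrite ps.
- exact: (etrans h0 (esym p0)).
- exact: (etrans h1 (esym p1)).
- by rewrite [LHS]hM [RHS]pM IHa IHb.
- by rewrite [LHS]hJ [RHS]pJ IHa IHb.
- by rewrite [LHS]hN [RHS]pN IHa.
Qed.

(* [sig] and [set] cannot be used here: the type [set algebra] in [variety]
   places the universe of carriers strictly below theirs. *)
Record class_of (A : Type) (E : A -> A -> Prop) : Type := ClassOf {
  members : A -> Prop;
  membersP : exists x, members = E x }.

(** * Quotient by a congruence *)

Section Quotient.

Variables (A : algebra) (E : A -> A -> Prop).
Hypothesis Erefl : forall x, E x x.
Hypothesis Esym : forall x y, E x y -> E y x.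
Hypothesis Etrans : forall x y z, E x y -> E y z -> E x z.
Hypothesis Emeet :
  forall x x' y y', E x x' -> E y y' -> E (meet x y) (meet x' y').
Hypothesis Ejoin :
  forall x x' y y', E x x' -> E y y' -> E (join x y) (join x' y').
Hypothesis Eneg : forall x x', E x x' -> E (neg x) (neg x').

(** The operations act on chosen representatives; compatibility of [E] makes the projection a
    homomorphism. *)
Lemma quotient_algebra :
  exists (B : algebra) (p : A -> B),
    [/\ is_hom p, (forall b, exists x, p x = b)
      & forall x y, p x = p y <-> E x y].
Proof.
pose p (x : A) : class_of E := @ClassOf A E (E x) (ex_intro _ x erefl).
have class_inj (b c : class_of E) : members b = members c -> b = c.
  case: b c => [m mP] [n nP] /= mn; rewrite mn in mP *.
  by congr ClassOf; exact: Prop_irrelevance.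
have pE x y : p x = p y <-> E x y.
  split=> [/(congr1 (@members _ _)) /= ->|Exy]; first exact: Erefl.
  apply: class_inj; apply/funext => z /=; apply/propext.
  by split; [exact: Etrans (Esym Exy)|exact: Etrans Exy].
have p_surj b : exists x, p x = b.
  by case: b => c [x cx]; exists x; apply: class_inj; exact: esym.
have [rep repK] := choice p_surj.
have repE x : E x (rep (p x)) by apply/pE; rewrite repK.
pose B := @Algebra (class_of E) (p (bot A)) (p (top A))
  (fun b c => p (meet (rep b) (rep c))) (fun b c => p (join (rep b) (rep c)))
  (fun b => p (neg (rep b))).
exists B, p; split=> //; split=> //= [x y|x y|x]; apply/pE.
- exact: Emeet.
- exact: Ejoin.
- exact: Eneg.
Qed.

End Quotient.

(** * Contexts and the iterated rules *)

Section Contexts.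

Variable V : Type.

Inductive frame := OrF of fm V | AndF of fm V | NegF.

Definition plug (phi : fm V) (f : frame) : fm V :=
  match f with
  | OrF chi => Or phi chi
  | AndF chi => And phi chi
  | NegF => Neg phi
  end.

(** The value that the fresh variable of this level must take; negation introduces no variable, so
    [Bot] is an arbitrary default. *)
Definition frame_arg (f : frame) : fm V :=
  match f with OrF chi | AndF chi => chi | NegF => Bot end.

(* The head of [c] is the innermost frame. *)
Definition fill (c : seq frame) (phi : fm V) : fm V := foldl plug phi c.

(** Once [Or] and [And] commute up to this relation, it is the Leibniz congruence of [T]. *)
Definition indiscernible (T : set (fm V)) (phi psi : fm V) : Prop :=
  forall c, T (fill c phi) <-> T (fill c psi).

Lemma indiscernible_plug T phi psi f :
  indiscernible T phi psi -> indiscernible T (plug phi f) (plug psi f).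
Proof. by move=> ind c; exact: (ind (f :: c)). Qed.

Lemma indiscernible_sym T phi psi :
  indiscernible T phi psi -> indiscernible T psi phi.
Proof. by move=> ind c; split=> /ind. Qed.

Lemma indiscernible_trans T phi psi chi :
  indiscernible T phi psi -> indiscernible T psi chi -> indiscernible T phi chi.
Proof. by move=> ind1 ind2 c; split=> [/ind1/ind2|/ind2/ind1]. Qed.

Lemma indiscernible_binary T (op : fm V -> fm V -> fm V) :
  (forall x y, indiscernible T (op x y) (op y x)) ->
  (forall x x' y, indiscernible T x x' -> indiscernible T (op x y) (op x' y)) ->
  forall x x' y y', indiscernible T x x' -> indiscernible T y y' ->
  indiscernible T (op x y) (op x' y').
Proof.
move=> opC op_l x x' y y' xx' yy'.
apply: indiscernible_trans (op_l _ _ _ xx') _.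
apply: indiscernible_trans (opC _ _) _.
apply: indiscernible_trans (op_l _ _ _ yy') _.
exact: opC.
Qed.

(** Each frame costs one iteration, and frame [i] is an instance of the step that uses [q i]. Both
    directions are carried along because the negation step swaps premise and conclusion. *)
Lemma rules_iter_fill (W : Type) (q : nat -> W) (R : set (rule W))
    (s : W -> fm V) phi psi :
  R (Rule [:: phi] psi) -> R (Rule [:: psi] phi) ->
  forall c, (forall i, i < size c -> s (q i) = frame_arg (nth NegF c i)) ->
  exists phi' psi',
    [/\ rules_iter q R (size c) (Rule [:: phi'] psi'),
        rules_iter q R (size c) (Rule [:: psi'] phi'),
        subst s phi' = fill c (subst s phi)
      & subst s psi' = fill c (subst s psi)].
Proof.
move=> R12 R21; elim/last_ind=> [_|c f IH sq]; first by exists phi, psi.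
have [i ic|phi' [psi' [r12 r21 sphi spsi]]] := IH.
  by rewrite sq ?nth_rcons ?ic // size_rcons ltnW.
(* The new outermost frame has index [size c], so its argument is the value of [q (size c)]. *)
have := sq (size c); rewrite size_rcons nth_rcons ltnn eqxx => /(_ (ltnSn _)).
rewrite /fill !foldl_rcons -!/(fill _ _) -sphi -spsi.
case: f {sq} => [chi|chi|] /= sqc.
- exists (Or phi' (Var (q (size c)))), (Or psi' (Var (q (size c)))).
  rewrite /= sqc; split=> //.
    by exists phi', psi'; split=> //; constructor 1.
  by exists psi', phi'; split=> //; constructor 1.
- exists (And phi' (Var (q (size c)))), (And psi' (Var (q (size c)))).
  rewrite /= sqc; split=> //.
    by exists phi', psi'; split=> //; constructor 2.
  by exists psi', phi'; split=> //; constructor 2.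
- exists (Neg phi'), (Neg psi'); split=> //.
    by exists psi', phi'; split=> //; constructor 3.
  by exists phi', psi'; split=> //; constructor 3.
Qed.

End Contexts.

(* A variable of the form [e v] that is also some [q n] gets the value [t n];
   freshness ensures that it occurs in no rule. *)
Lemma fresh_subst (U V W : Type) (e : U -> W) (q : nat -> W) (t : nat -> fm V)
    (s : U -> fm V) :
  injective e -> injective q ->
  exists s' : W -> fm V, (forall n, s' (q n) = t n) /\
    forall phi, (forall n, ~ occurs (q n) (subst (fun v => Var (e v)) phi)) ->
    subst s' (subst (fun v => Var (e v)) phi) = subst s phi.
Proof.
move=> e_inj q_inj.
have [s' s'P] : {s' : W -> fm V & forall w, (forall n, w = q n -> s' w = t n) /\
    forall v, w = e v -> (forall n, w <> q n) -> s' w = s v}.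
  apply: (@choice _ _ (fun w y => (forall n, w = q n -> y = t n) /\
    forall v, w = e v -> (forall n, w <> q n) -> y = s v)) => w.
  have [[n wq]|wNq] := pselect (exists n, w = q n).
    exists (t n); split=> [m|v _ /(_ n)//].
    by rewrite wq => /q_inj ->.
  have {}wNq n : w <> q n by move=> wq; apply: wNq; exists n.
  have [[v we]|wNe] := pselect (exists v, w = e v).
    by exists (s v); split=> [n /wNq//|u]; rewrite we => /e_inj ->.
  by exists Bot; split=> [n /wNq//|v we]; case: wNe; exists v.
exists s'; split=> [n|phi qphi]; first exact: (s'P _).1.
rewrite subst_comp; apply: eq_subst_occurs => v v_phi /=.
apply: (s'P _).2 => // n en; apply: (qphi n).
by rewrite -en; exact: occurs_rename.
Qed.

(** * Soundness *)

(** Equal values stay equal under every operation, and equality is symmetric, so the swap in the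
    negation rule is harmless. *)
Lemma rules_iter_valid (W : Type) (A : algebra) (q : nat -> W) (R : set (rule W))
    (g : fm_algebra W -> A) :
  is_hom g ->
  (forall r, R r -> exists phi, prems r = [:: phi] /\ g phi = g (concl r)) ->
  forall n r, rules_iter q R n r ->
  exists phi, prems r = [:: phi] /\ g phi = g (concl r).
Proof.
move=> [_ _ gM gJ gN] Rg; elim=> [//|n IH r /= [phi [psi [/IH[_ [[<-] /= E]]]]]].
case=> -> /=; eexists; split=> //.
- by rewrite [LHS]gJ [RHS]gJ E.
- by rewrite [LHS]gM [RHS]gM E.
- by rewrite [LHS]gN [RHS]gN E.
Qed.

Lemma rules_of_valid (V W : Type) (Eq : set (equation V)) (e : V -> W)
    (A : algebra) (g : fm_algebra W -> A) r :
  variety Eq A -> is_hom g -> (rename_rule e @` rules_of Eq) r ->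
  exists phi, prems r = [:: phi] /\ g phi = g (concl r).
Proof.
move=> VA g_hom [r0 [phi [psi [Eqn H]]] <-].
have /= E := VA _ Eqn _ (is_hom_subst (fun v => Var (e v)) g_hom).
pose ren := subst (fun v => Var (e v)).
by case: H => ->; [exists (ren phi)|exists (ren psi)].
Qed.

Lemma soundness (Eq : set (equation nat)) (W : Type) (e : nat -> W)
    (q : nat -> W) (Gamma : set (fm nat)) phi :
  DN `<=` Eq ->
  derivable (rules_omega q (rename_rule e @` rules_of Eq)
             `|` rename_rule e @` rules_F) Gamma phi ->
  order_consequence (variety Eq) Gamma phi.
Proof.
move=> DNEq [l dl] A VA F [[x0 Fx0] Fmeet Fup] h h_hom hGamma.
(* Absorption says that x lies below x ∨ y in the sense of [le]. *)
have absorb (g : fm_algebra nat -> A) : is_hom g ->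
    meet (g (Var 0)) (join (g (Var 0)) (g (Var 1))) = g (Var 0).
  move=> g_hom; have [_ _ gM gJ _] := g_hom.
  have := VA (Var 0 ∧ (Var 0 ∨ Var 1) ≈ Var 0)%fm.
  rewrite /satisfies /= => /(_ (DNEq _ ltac:(by do 7 right; left)) g g_hom).
  by rewrite [X in X = _ -> _]gM [X in meet _ X = _ -> _]gJ.
suff: forall psi, List.In psi (phi :: l) -> F (h psi) by apply; left.
elim: dl => [//|psi l' _ IH Gpsi|r s l' _ IH Rr prem_l] psi'.
  by move=> [<-|/IH//]; apply: hGamma; exists psi.
move=> [<-|/IH//].
have Fprem p : List.In p (prems r) -> F (h (subst s p)).
  by move=> /prem_l/IH.
have g_hom := is_hom_subst s h_hom.
case: Rr => [[n _ rn]|[r0 Fr re]].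
  have [p [pr E]] := rules_iter_valid g_hom
    (fun r' => rules_of_valid VA g_hom) rn.
  by rewrite /= -E; apply: Fprem; rewrite pr; left.
have [h0 h1 hM hJ hN] := h_hom.
case: Fr re => [<-|[<-|[<-|[]]]] re; rewrite -re /= in Fprem *.
- rewrite [h _]h1; apply: Fup Fx0 _.
  (* Absorption for [x0] and [top A], together with x ∨ ⊤ ≈ ⊤, puts [x0] below [top A]. *)
  have := absorb _ (is_hom_eval (fun n => if n is 0 then x0 else top A)).
  have /= := VA (Var 0 ∨ ⊤ ≈ ⊤)%fm (DNEq _ ltac:(by do 9 right; left)) _
    (is_hom_eval (fun n : nat => if n is 0 then x0 else top A)).
  by rewrite /le => -> .
- rewrite [h _]hM; apply: Fmeet; first exact: (Fprem (Var (e 0)) (or_introl erefl)).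
  exact: (Fprem (Var (e 1)) (or_intror (or_introl erefl))).
- rewrite [h _]hJ; apply: Fup (Fprem _ (or_introl erefl)) _.
  exact: (absorb _ (is_hom_subst (fun v => Var (e v)) g_hom)).
Qed.

(** * Completeness *)

Lemma completeness (Eq : set (equation nat)) (W : Type) (e : nat -> W)
    (q : nat -> W) (Gamma : set (fm nat)) phi :
  DN `<=` Eq -> injective e -> fresh q (rename_rule e @` rules_of Eq) ->
  order_consequence (variety Eq) Gamma phi ->
  derivable (rules_omega q (rename_rule e @` rules_of Eq)
             `|` rename_rule e @` rules_F) Gamma phi.
Proof.
move=> DNEq e_inj [q_inj q_fresh] Hphi.
set R := (X in derivable X); pose T : set (fm nat) := derivable R Gamma.
have indEq a b (s : nat -> fm nat) :
    Eq (a, b) -> indiscernible T (subst s a) (subst s b).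
  move=> Eqab c.
  (* [s'] acts as [s] on the equation and sends each [q i] to the argument of frame [i] of [c];
     beyond [size c] the default is harmless. *)
  have [s' [s'q s'e]] := fresh_subst
    (fun i => frame_arg (nth (NegF _) c i)) s e_inj q_inj.
  pose ren := subst (fun v => Var (e v)).
  have Rab : (rename_rule e @` rules_of Eq) (Rule [:: ren a] (ren b)).
    by exists (Rule [:: a] b) => //; exists a, b; split=> //; left.
  have Rba : (rename_rule e @` rules_of Eq) (Rule [:: ren b] (ren a)).
    by exists (Rule [:: b] a) => //; exists a, b; split=> //; right.
  (* Each side of the equation is the conclusion of one of the two rules, so freshness applies to
     it. *)
  have sa : subst s' (ren a) = subst s a.
    by apply: s'e => n qa; apply: (q_fresh n _ Rba); left.
  have sb : subst s' (ren b) = subst s b.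
    by apply: s'e => n qb; apply: (q_fresh n _ Rab); left.
  have [a' [b' [rab rba]]] := rules_iter_fill Rab Rba (fun i _ => s'q i).
  rewrite sa sb => <- <-; split=> Tc.
    apply: (derivable_rule (r := Rule [:: a'] b')) => [|p [<-|[]]//].
    by left; exists (size c).
  apply: (derivable_rule (r := Rule [:: b'] a')) => [|p [<-|[]]//].
  by left; exists (size c).
pose val3 (x y z : fm nat) n := match n with 0 => x | 1 => y | _ => z end.
have orC x y : indiscernible T (Or x y) (Or y x).
  exact: (indEq (Var 0 ∨ Var 1)%fm (Var 1 ∨ Var 0)%fm (val3 x y y)
    (DNEq _ ltac:(by left))).
have andC x y : indiscernible T (And x y) (And y x).
  exact: (indEq (Var 0 ∧ Var 1)%fm (Var 1 ∧ Var 0)%fm (val3 x y y)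
    (DNEq _ ltac:(by right; left))).
have absorb x y : indiscernible T (Or x (And x y)) x.
  exact: (indEq (Var 0 ∨ (Var 0 ∧ Var 1))%fm (Var 0) (val3 x y y)
    (DNEq _ ltac:(by do 6 right; left))).
have val2 (x y : fm nat) : exists s : W -> fm nat, s (e 0) = x /\ s (e 1) = y.
  exists (fun w => if pselect (w = e 0) then x else y).
  by split; case: pselect => [E|] //=; have := e_inj _ _ E.
have T_top : T Top.
  apply: (derivable_rule (r := Rule [::] Top) (s := fun=> Top)) => //.
  by right; exists (Rule [::] Top) => //; left.
have T_and x y : T x -> T y -> T (And x y).
  have [s [sx sy]] := val2 x y; move=> Tx Ty.
  rewrite -sx -sy; apply: (derivable_rule (s := s)
    (r := Rule [:: Var (e 0); Var (e 1)] (And (Var (e 0)) (Var (e 1))))).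
    right; exists (Rule [:: Var 0; Var 1] (And (Var 0) (Var 1))) => //.
    by right; left.
  by move=> p [<-|[<-|[]]] /=; rewrite ?sx ?sy.
have T_or x y : T x -> T (Or x y).
  have [s [sx sy]] := val2 x y; move=> Tx.
  rewrite -sx -sy; apply: (derivable_rule (s := s)
    (r := Rule [:: Var (e 0)] (Or (Var (e 0)) (Var (e 1))))).
    right; exists (Rule [:: Var 0] (Or (Var 0) (Var 1))) => //.
    by right; right; left.
  by move=> p /= [<-|[]] /=; rewrite sx.
have [||||||B [p [p_hom p_surj pE]]] :=
  @quotient_algebra (fm_algebra nat) (indiscernible T).
- by [].
- exact: indiscernible_sym.
- exact: indiscernible_trans.
- apply: (indiscernible_binary andC) => x x' y.
  exact: (@indiscernible_plug _ _ _ _ (AndF y)).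
- apply: (indiscernible_binary orC) => x x' y.
  exact: (@indiscernible_plug _ _ _ _ (OrF y)).
- by move=> x x'; exact: (@indiscernible_plug _ _ _ _ (NegF _)).
have [_ _ pM _ _] := p_hom.
(* The empty context already separates members of [T] from non-members. *)
have TP x : (p @` T) (p x) -> T x.
  by move=> [y Ty /pE /(_ [::])] [+ _]; exact.
apply: TP; apply: (Hphi B _ _ _ p p_hom).
- move=> [a b] Eqab h h_hom /=.
  (* Representatives of the values of the variables form a substitution through which [h]
     factors. *)
  have [s sP] := choice (fun v => p_surj (h (Var v))).
  rewrite !(hom_eq_subst p_hom h_hom sP).
  by apply/pE; exact: indEq.
- split=> [|_ _ [x Tx <-] [y Ty <-]|_ b [x Tx <-]].
  + by exists (p Top), Top.
  + by exists (And x y); [exact: T_and|exact: pM].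
  + have [y <-] := p_surj b; rewrite /le -pM => /pE xy.
    exists y => //.
    (* Upward closure: membership in [T] passes from x to x ∧ y, y ∧ x, (y ∧ x) ∨ y, y ∨ (y ∧ x),
       and by absorption to y. *)
    have Txy : T (And y x) by apply/(andC x y [::])/(xy [::]).
    by apply/(absorb y x [::])/(orC (And y x) y [::]); exact: T_or.
- by move=> _ [x Gx <-]; exists x => //; exact: derivable_hyp.
Qed.

(* Formulas are built from the variables [nat].  Since [Eq] may mention every
   one of them, the variables of the rules range over a set [W] into which
   [nat] embeds along [e], and which contains the fresh variables [q n].  Taking
   [e := id] is the case where the [q n] are ordinary variables; [W := nat + nat]
   with [e := inl] and [q := inr] is possible for every [Eq]. *)
Theorem theorem3p3 (Eq : set (equation nat)) (W : Type) (e : nat -> W)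
    (q : nat -> W) :
  DN `<=` Eq ->
  injective e ->
  fresh q (rename_rule e @` rules_of Eq) ->
  forall (Gamma : set (fm nat)) (phi : fm nat),
    derivable (rules_omega q (rename_rule e @` rules_of Eq)
               `|` rename_rule e @` rules_F) Gamma phi
    <-> order_consequence (variety Eq) Gamma phi.
Proof.
move=> DNEq e_inj q_fresh Gamma phi.
by split; [exact: soundness|exact: completeness].
Qed.
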